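(* Let $n\in\mathbb{N}$ and let $K\in L^1(\mathbb{R}^n)$ be a radial function. Then, for any $\epsilon>0$, there exist $N\in\mathbb{N}$, constants $\{\alpha_j\}_{1\le j\le N}\subset\mathbb{R}$ and positive constants $\{d_j\}_{1\le j\le N}$ such that $$\|K-K_N\|_{L^1}<\epsilon$$ holds, where $K_N(x)=\sum_{j=1}^N\alpha_jk_j(x)$.
   Context: For $d_j>0$, $k_j$ is the Green function of $-d_j\Delta+1$ on $\mathbb{R}^n$, given by $$k_j(x)=d_j^{-n/2}G\Big(\frac{|x|}{\sqrt{d_j}}\Big),\quad G(r)=\frac{1}{(2\pi)^{n/2}}\Big(\frac1r\Big)^{n/2-1}M_{n/2-1}(r),\quad M_\nu(r)=\int_0^{+\infty}e^{-r\cosh s}\cosh(\nu s)\,ds,$$ where $M_\nu$ is the modified Bessel function of the second kind of order $\nu$. *)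

(* Defs.v *)
From HB Require Import structures.
From mathcomp Require Import all_boot all_order all_algebra.
From mathcomp Require Import all_classical all_reals all_analysis.

Set Implicit Arguments.
Unset Strict Implicit.
Unset Printing Implicit Defensive.
Import Order.TTheory GRing.Theory Num.Theory.
Import numFieldNormedType.Exports.

Local Open Scope classical_set_scope.
Local Open Scope ring_scope.

(* R^n, with the Borel sigma-algebra generated by the coordinates. *)
Notation Rn R n := (n.-tuple (measurableTypeR R)).

Section lebesgue_Rn.
Context {R : realType}.

Definition consRn n (p : measurableTypeR R * Rn R n) : Rn R n.+1 :=
  [tuple of p.1 :: p.2].

Definition unconsRn n (x : Rn R n.+1) : measurableTypeR R * Rn R n :=
  (thead x, [tuple of behead x]).

Lemma consRnK n : cancel (@consRn n) (@unconsRn n).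
Proof. by move=> [a t]; congr pair; apply/val_inj. Qed.

Lemma unconsRnK n : cancel (@unconsRn n) (@consRn n).
Proof. by move=> x; rewrite [RHS]tuple_eta; apply/val_inj. Qed.

Lemma measurable_consRn n : measurable_fun [set: _] (@consRn n).
Proof. by apply: measurable_cons. Qed.

Lemma measurable_unconsRn n : measurable_fun [set: _] (@unconsRn n).
Proof.
apply/measurable_fun_pair; last exact: measurable_behead.
exact: (measurable_tnth ord0).
Qed.

Section cons_measure.
Local Open Scope ereal_scope.
Variables (n : nat) (mu : {sigma_finite_measure set (Rn R n) -> \bar R}).

Definition cons_measure : set (Rn R n.+1) -> \bar R :=
  pushforward (@lebesgue_measure R \x mu) (@consRn n).

Let cons_measure0 : cons_measure set0 = 0.
Proof. by rewrite /cons_measure /pushforward preimage_set0 measure0. Qed.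

Let cons_measure_ge0 A : 0 <= cons_measure A.
Proof. by rewrite /cons_measure /pushforward measure_ge0. Qed.

Let measurable_preimage_consRn A :
  measurable A -> measurable (@consRn n @^-1` A).
Proof.
by move=> mA; rewrite -[X in measurable X]setTI; exact: measurable_consRn.
Qed.

Let cons_measure_sigma_additive : semi_sigma_additive cons_measure.
Proof.
move=> F mF tF mUF; rewrite /cons_measure /pushforward preimage_bigcup.
apply: measure_semi_sigma_additive.
- by move=> k; exact: measurable_preimage_consRn.
- apply/trivIsetP => /= i j _ _ ij; rewrite -preimage_setI.
  by move/trivIsetP : tF => /(_ _ _ _ _ ij) ->//; rewrite preimage_set0.
- by rewrite -preimage_bigcup; exact: measurable_preimage_consRn.
Qed.

HB.instance Definition _ := isMeasure.Build _ _ _ cons_measure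
  cons_measure0 cons_measure_ge0 cons_measure_sigma_additive.

Let cons_measure_sigma_finite : sigma_finite [set: Rn R n.+1] cons_measure.
Proof.
have /sigma_finiteP[F [TF ndF Foo]] := sigma_finiteT (@lebesgue_measure R).
have /sigma_finiteP[G [TG ndG Goo]] := sigma_finiteT mu.
exists (fun k => @unconsRn n @^-1` (F k `*` G k)).
  rewrite -preimage_bigcup; apply/esym/seteqP; split => // x _ /=.
  have := I : [set: _] (thead x); rewrite TF => -[k _ Fk].
  have := I : [set: _] [tuple of behead x]; rewrite TG => -[l _ Gl].
  exists (maxn k l) => //; split => /=.
    by move: Fk; exact/subsetPset/ndF/leq_maxl.
  by move: Gl; exact/subsetPset/ndG/leq_maxr.
move=> k; have [mFk Fkoo] := Foo k; have [mGk Gkoo] := Goo k; split.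
  rewrite -[X in measurable X]setTI; apply: measurable_unconsRn => //.
  exact: measurableX.
rewrite /cons_measure /pushforward -comp_preimage.
rewrite (_ : _ \o _ = id); last by apply/funext => p /=; rewrite consRnK.
by rewrite preimage_id product_measure1E// lte_mul_pinfty// ge0_fin_numE.
Qed.

HB.instance Definition _ := Measure_isSigmaFinite.Build _ _ _ cons_measure
  cons_measure_sigma_finite.

End cons_measure.

(* n-dimensional Lebesgue measure, as an iterated product on Borel sets;
   lebesgue_Rn_box characterizes it by its values on measurable boxes. *)
Fixpoint lebesgue_Rn n : {sigma_finite_measure set (Rn R n) -> \bar R} :=
  if n is m.+1 then cons_measure (lebesgue_Rn m) else \d_[tuple].

Lemma lebesgue_Rn_box n (A : 'I_n -> set (measurableTypeR R)) :
  (forall i, measurable (A i)) ->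
  lebesgue_Rn n [set x | forall i, A i (tnth x i)] =
  (\prod_(i < n) lebesgue_measure (A i))%E.
Proof.
elim: n A => [|n IH] A mA.
  by rewrite big_ord0 /= diracE mem_set// => -[].
rewrite big_ord_recl /= -IH// /cons_measure /pushforward.
have mB : measurable [set x : Rn R n | forall i, A (lift ord0 i) (tnth x i)].
  rewrite (_ : [set x | _] = \bigcap_(i in [set: 'I_n])
      ((@tnth n (measurableTypeR R))^~ i @^-1` A (lift ord0 i))).
    apply: fin_bigcap_measurable => // i _.
    by rewrite -[X in measurable X]setTI; exact: measurable_tnth.
  by apply/seteqP; split => x /= h i; [move=> _|]; exact: h.
rewrite -product_measure1E//; congr (_ _).
apply/seteqP; split => -[a t] /= => [h|[h0 h] i].
  split; first by have := h ord0; rewrite tnth0.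
  by move=> i; have := h (lift ord0 i); rewrite tnthS.
by case: (unliftP ord0 i) => [j ->|->]; rewrite ?tnthS ?tnth0.
Qed.

End lebesgue_Rn.

Section green.
Context {R : realType}.

Definition norm2 n (x : Rn R n) : R := Num.sqrt (\sum_(i < n) tnth x i ^+ 2).

(* Elements of L^1 are classes modulo equality almost everywhere: a Borel
   representative is radial when it agrees a.e. with a function of |x|. *)
Definition radial n (f : Rn R n -> R) : Prop :=
  exists g : R -> R, {ae lebesgue_Rn n, forall x, f x = g (norm2 x)}.

Definition cosh (x : R) : R := (expR x + expR (- x)) / 2.

(* Modified Bessel function of the second kind, for r > 0. For r = 0 the
   integral is +oo and Rintegral returns 0: this only affects the value of
   green at the origin, a negligible set for n > 0. *)
Definition besselK (nu r : R) : R :=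
  \int[lebesgue_measure]_(s in `[0%R, +oo[) (expR (- r * cosh s) * cosh (nu * s)).

Definition greenG (n : nat) (r : R) : R :=
  ((2 * pi) `^ (n%:R / 2))^-1 * r^-1 `^ (n%:R / 2 - 1) *
  besselK (n%:R / 2 - 1) r.

(* Green function of - d Laplacian + 1 on R^n, for d > 0. *)
Definition green (n : nat) (d : R) (x : Rn R n) : R :=
  d `^ (- (n%:R / 2)) * greenG n (norm2 x / Num.sqrt d).

End green.

(* Main.v *)
From HB Require Import structures.
Require Import Defs.
From mathcomp Require Import all_boot all_order all_algebra.
From mathcomp Require Import all_classical all_reals all_analysis.
From mathcomp Require Import measurable_realfun measurable_fun_approximation.
From mathcomp Require Import ring lra.

(** The Green function of - d Delta + 1 is the resolvent of the heat
    semigroup: it is the mixture of the heat kernels H_t for the exponential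
    law of mean d on the times t ([green_mixture]). Let V be the closed linear
    span of the Green functions in L^1.

    Since every H_t has mass 1, mixing heat kernels is a contraction from the
    integrable functions of t to L^1 ([L1dist_mixture]). For d = 1 / (j + 1)
    the law of t has density (j + 1) u ^ (j + 1) with u = exp(- t), and
    positive powers of u have a dense span among the integrable functions of
    t. So V contains all mixtures of heat kernels
    ([mixture_heat_in_green_span]) and, by averaging over short intervals of
    time, all Gaussians ([gauss_in_green_span]).

    The Gaussians exp(- (j + 1) |x| ^ 2) are again the positive powers of one
    function u = exp(- |x| ^ 2), so that the same density argument yields all
    integrable Borel functions of |x| ([radial_in_green_span]). It is the
    subject of [closed_subspace_powers]: polynomials such as (1 - u ^ k) ^ m,
    with m growing suitably with k, tend to the indicator of u < c, and
    measure theory does the rest.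

    It remains that an integrable function which is almost everywhere equal to
    g (|x|), for an arbitrary g, is almost everywhere equal to a Borel
    function of |x| ([radial_borel]). Polar coordinates would give it; here it
    is obtained from Tonelli's theorem on pairs (c, x) and from the fact that
    the dilations x |-> c x preserve null sets. *)

Set Implicit Arguments.
Unset Strict Implicit.
Unset Printing Implicit Defensive.
Import Order.TTheory GRing.Theory Num.Theory.
Import numFieldNormedType.Exports.

Local Open Scope classical_set_scope.
Local Open Scope ring_scope.

(** * Closed subspaces of the space of integrable functions *)

Section closed_subspaces.
Context d (T : measurableType d) (R : realType).
Variable mu : {measure set T -> \bar R}.
Implicit Types f g : T -> R.

Definition L1 f := mu.-integrable [set: T] (EFin \o f).

Definition L1dist f g : \bar R := (\int[mu]_x `|f x - g x|%:E)%E.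

(** Functions are not quotiented by almost everywhere equality; [closed_ae]
    recovers the invariance from the closure under limits, since functions
    equal almost everywhere are at distance zero. *)
Record closed_subspace (V : (T -> R) -> Prop) : Prop := ClosedSubspace {
  closed_L1 : forall f, V f -> L1 f;
  closed0 : V (fun=> 0);
  closedD : forall f g, V f -> V g -> V (fun x => f x + g x);
  closedZ : forall c f, V f -> V (fun x => c * f x);
  closed_lim : forall f, L1 f ->
    (forall e, 0 < e -> exists2 g, V g & (L1dist f g < e%:E)%E) -> V f }.

Lemma L1_measurable f : L1 f -> measurable_fun setT f.
Proof. by move=> /measurable_int/measurable_EFinP. Qed.

Lemma L1D f g : L1 f -> L1 g -> L1 (fun x => f x + g x).
Proof.
move=> f1 g1; rewrite /L1 (_ : _ \o _ = (EFin \o f) \+ (EFin \o g))%E//.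
exact: integrableD.
Qed.

Lemma L1Z c f : L1 f -> L1 (fun x => c * f x).
Proof.
move=> f1; rewrite /L1 (_ : _ \o _ = fun x => c%:E * (EFin \o f) x)%E//.
exact: integrableZl.
Qed.

Lemma le_L1 f g : measurable_fun setT f -> L1 g ->
  (forall x, `|f x| <= `|g x|) -> L1 f.
Proof.
move=> mf g1 fg; apply: le_integrable g1 => //; first exact/measurable_EFinP.
by move=> x _ /=; rewrite lee_fin.
Qed.

Lemma L1_ae f g : L1 g -> measurable_fun setT f ->
  {ae mu, forall x, g x = f x} -> L1 f.
Proof.
move=> /integrableP[mg gfin] mf gf.
have mf' : measurable_fun setT (EFin \o f) by exact/measurable_EFinP.
apply/integrableP; split => //; apply: le_lt_trans gfin.
rewrite le_eqVlt; apply/orP; left; apply/eqP.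
apply: ge0_ae_eq_integral => //; [exact: measurableT_comp..|].
by apply: filterS gf => x /= ->.
Qed.

Lemma L1distC f g : L1dist f g = L1dist g f.
Proof. by apply: eq_integral => x _; rewrite distrC. Qed.

Lemma L1dist_triangle g f h : L1 f -> L1 g -> L1 h ->
  (L1dist f h <= L1dist f g + L1dist g h)%E.
Proof.
move=> /L1_measurable mf /L1_measurable mg /L1_measurable mh.
have md (a b : T -> R) : measurable_fun setT a -> measurable_fun setT b ->
    measurable_fun [set: T] (fun x => `|a x - b x|%:E).
  move=> ma mb; apply/measurable_EFinP; apply: measurableT_comp => //.
  exact: measurable_funB.
rewrite /L1dist -ge0_integralD//; [|exact: md..].
apply: ge0_le_integral => //; [exact: md| |].
- by apply: emeasurable_funD; exact: md.
- by move=> x _; rewrite -EFinD lee_fin -[f x - h x](subrKA (g x)) ler_normD.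
Qed.

Section closure.
Variable V : (T -> R) -> Prop.
Hypothesis cV : closed_subspace V.

Lemma closed_sum I (s : seq I) (f : I -> T -> R) :
  (forall i, V (f i)) -> V (fun x => \sum_(i <- s) f i x).
Proof.
move=> Vf; elim: s => [|i s IH].
  by under [X in V X]eq_fun do rewrite big_nil; exact: (closed0 cV).
by under [X in V X]eq_fun do rewrite big_cons; exact: (closedD cV).
Qed.

Lemma closedB f g : V f -> V g -> V (fun x => f x - g x).
Proof.
move=> Vf Vg; under [X in V X]eq_fun do rewrite -mulN1r.
by apply: (closedD cV) => //; exact: (closedZ cV).
Qed.

(** Dominated convergence is the way limits are taken below: a dominated
    pointwise limit is a limit in mean. *)
Lemma closed_dct f g (h : nat -> T -> R) : measurable_fun setT f -> L1 g ->
  (forall k, V (h k)) -> (forall k x, `|h k x| <= g x) ->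
  {ae mu, forall x, h k x @[k --> \oo] --> f x} -> V f.
Proof.
move=> mf g1 Vh hg hf.
have [] := @dominated_convergence _ _ _ mu _ measurableT (fun k => EFin \o h k)
  (EFin \o f) (EFin \o g) _ _ _ _ _.
- by move=> k; exact: measurable_int (closed_L1 cV (Vh k)).
- exact/measurable_EFinP.
- apply: filterS hf => x hfx _; apply/cvg_EFin => //.
    by apply: nearW.
- exact: g1.
- by apply: nearW => x k _ /=; rewrite lee_fin.
move=> f1 h0 _; apply: (closed_lim cV) => // e e0.
move/fine_cvgP : h0 => [finh /cvgrPdist_lt /(_ _ e0) he].
near \oo => k.
have : `|0 - fine (\int[mu]_x `|(EFin \o h k) x - (EFin \o f) x|)%E| < e.
  by near: k.
have : (\int[mu]_x `|(EFin \o h k) x - (EFin \o f) x|)%E \is a fin_num.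
  by near: k.
rewrite sub0r normrN => fk he'.
exists (h k); first exact: Vh.
rewrite L1distC /L1dist.
move: he' fk; rewrite -lte_fin => + fk.
rewrite ger0_norm ?fineK//.
by apply: fine_ge0; exact: integral_ge0.
Unshelve. all: by end_near.
Qed.

Lemma closed_ae f g : V g -> measurable_fun setT f ->
  {ae mu, forall x, g x = f x} -> V f.
Proof.
move=> Vg mf gf; apply: (@closed_dct _ (fun x => `|g x|) (fun=> g)) => //.
  by have := integrable_abse (closed_L1 cV Vg).
by apply: filterS gf => x ->; exact: cvg_cst.
Qed.

End closure.
End closed_subspaces.

(** * The closed linear span of a family *)

Section approximable.
Context d (T : measurableType d) (R : realType).
Variables (mu : {measure set T -> \bar R}) (I : Type) (G : I -> T -> R).
Hypothesis G1 : forall i, L1 mu (G i).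

Definition lincomb (s : seq (R * I)) x := \sum_(p <- s) p.1 * G p.2 x.

Definition approximable f := L1 mu f /\
  forall e, 0 < e -> exists s, (L1dist mu f (lincomb s) < e%:E)%E.

Lemma L1_lincomb s : L1 mu (lincomb s).
Proof.
elim: s => [|p s IH]; rewrite /lincomb.
  by under eq_fun do rewrite big_nil; exact: integrable0.
by under eq_fun do rewrite big_cons; apply: L1D => //; exact: L1Z.
Qed.

Lemma approximable_lincomb s : approximable (lincomb s).
Proof.
split; first exact: L1_lincomb.
move=> e e0; exists s; rewrite /L1dist.
by under eq_integral do rewrite subrr normr0; rewrite integral0 lte_fin.
Qed.

Lemma approximable_gen i : approximable (G i).
Proof.
have := approximable_lincomb [:: (1, i)]; rewrite /lincomb.
by under [X in approximable X]eq_fun do rewrite big_seq1 mul1r.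
Qed.

Lemma closed_approximable : closed_subspace mu approximable.
Proof.
have dm f g : L1 mu f -> L1 mu g ->
    measurable_fun [set: T] (fun x => `|f x - g x|%:E).
  move=> /L1_measurable mf /L1_measurable mg.
  by apply/measurable_EFinP; apply: measurableT_comp => //; exact: measurable_funB.
split.
- by move=> f [].
- have := approximable_lincomb [::]; rewrite /lincomb.
  by under [X in approximable X]eq_fun do rewrite big_nil.
- move=> f g [f1 fs] [g1 gs]; split; first exact: L1D.
  move=> e e0; have e20 : 0 < e / 2 by rewrite divr_gt0.
  have [s hs] := fs _ e20; have [t ht] := gs _ e20; exists (s ++ t).
  rewrite (splitr e) EFinD; apply: le_lt_trans (lteD hs ht).
  rewrite /L1dist -ge0_integralD//; [|exact: dm (L1_lincomb _)..].
  apply: ge0_le_integral => //.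
  + by apply: dm (L1_lincomb _); exact: L1D.
  + by apply: emeasurable_funD; exact: dm (L1_lincomb _).
  + move=> x _; rewrite -EFinD lee_fin /lincomb big_cat/= opprD addrACA.
    exact: ler_normD.
- move=> c f [f1 fs]; split; first exact: L1Z.
  move=> e e0; have c0 : 0 < e / (`|c| + 1) by rewrite divr_gt0// ltr_wpDl.
  have [s hs] := fs _ c0; exists [seq (c * p.1, p.2) | p <- s].
  have -> : L1dist mu (fun x => c * f x) (lincomb [seq (c * p.1, p.2) | p <- s])
      = (`|c|%:E * L1dist mu f (lincomb s))%E.
    rewrite /L1dist -ge0_integralZl//; [|exact: dm (L1_lincomb _)..].
    apply: eq_integral => x _; rewrite -EFinM -normrM mulrBr; congr (`|_ - _|%:E).
    by rewrite /lincomb big_map mulr_sumr; apply: eq_bigr => p _; rewrite mulrA.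
  apply: (@le_lt_trans _ _ ((`|c| + 1)%:E * L1dist mu f (lincomb s)))%E.
    by rewrite lee_wpmul2r ?lee_fin ?lerDl// integral_ge0.
  by rewrite muleC -lte_pdivlMr// ltr_wpDl.
- move=> f f1 fV; split => // e e0.
  have e20 : 0 < e / 2 by rewrite divr_gt0.
  have [g [g1 gs] fg] := fV _ e20; have [s hs] := gs _ e20; exists s.
  apply: le_lt_trans (L1dist_triangle f1 g1 (L1_lincomb _)) _.
  by rewrite (splitr e) EFinD; exact: lteD.
Qed.

End approximable.

(** * Functions of u from the powers of u *)

Section step_approximation.
Variable R : realType.
Implicit Types v c q y : R.

Lemma bernoulli_inequality y m : -1 <= y -> 1 + m%:R * y <= (1 + y) ^+ m.
Proof.
move=> y1; elim: m => [|m IH]; first by rewrite mul0r addr0 expr0.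
rewrite exprS; apply: (@le_trans _ _ ((1 + y) * (1 + m%:R * y))).
  rewrite -natr1; have : 0 <= m%:R * y ^+ 2 by rewrite mulr_ge0 ?sqr_ge0.
  by move=> ?; nra.
by rewrite ler_wpM2l//; lra.
Qed.

Lemma cvg_natr_expr0 q : 0 <= q < 1 -> k%:R * q ^+ k @[k --> \oo] --> 0.
Proof.
move=> /andP[q0 q1]; have [->|qn0] := eqVneq q 0.
  apply: (@cvg_trans _ (cst (0 : R) @ \oo)); last exact: cvg_cst.
  apply: near_eq_cvg; near=> k => /=.
  have k0 : (0 < k)%N by near: k; exact: nbhs_infty_gt.
  by rewrite expr0n gtn_eqF// mulr0.
have {q0 qn0} q0 : 0 < q by rewrite lt_neqAle eq_sym qn0.
(* k q ^ k = (k s ^ k) s ^ k, and k s ^ k is bounded by Bernoulli for 1 / s. *)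
pose s := Num.sqrt q.
have s0 : 0 < s by rewrite sqrtr_gt0.
have qs : q = s ^+ 2 by rewrite sqr_sqrtr// ltW.
have s1 : s < 1 by move: q1; rewrite qs expr_lt1// ltW.
have ks k : k%:R * s ^+ k <= (s^-1 - 1)^-1.
  have h : k%:R * (s^-1 - 1) <= s^-1 ^+ k.
    have s'0 : 0 < s^-1 by rewrite invr_gt0.
    have /(_ ltac:(lra)) := @bernoulli_inequality (s^-1 - 1) k.
    by rewrite subrKC; lra.
  rewrite -[_^-1]div1r ler_pdivlMr ?subr_gt0 ?invf_gt1//.
  rewrite mulrAC -ler_pdivlMr ?exprn_gt0// div1r -exprVn//.
apply: (@squeeze_cvgr _ _ _ _ (cst 0) (fun k => (s^-1 - 1)^-1 * s ^+ k)).
- apply: nearW => k; rewrite mulr_ge0 ?exprn_ge0 ?(ltW q0)//=.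
  by rewrite qs -exprM mulnC exprM expr2 mulrA ler_wpM2r ?exprn_ge0 ?(ltW s0).
- exact: cvg_cst.
- rewrite -[X in _ --> X](mulr0 (s^-1 - 1)^-1); apply: cvgMl_tmp.
  by apply: cvg_expr; rewrite ger0_norm// ltW.
Unshelve. all: by end_near. Qed.

(** An exponent of order k / c ^ k makes (1 - v ^ k) raised to it tend to 1
    when v < c, because k (v / c) ^ k tends to 0, and to 0 when c <= v,
    because k (v / c) ^ k tends to infinity. The factor k is what makes the
    limit 0, rather than 1 / e, at v = c itself. *)
Definition step_exponent c k := (Num.truncn (k%:R / c ^+ k)).+1.

(** The upper bound for c <= v comes from (1 - y) ^ m (1 + y) ^ m <= 1 and the
    Bernoulli inequality for (1 + y) ^ m. *)
Lemma cvg_step c v : 0 < c <= 1 -> 0 <= v <= 1 ->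
  (1 - v ^+ k) ^+ step_exponent c k @[k --> \oo] --> ((v < c)%R%:R : R).
Proof.
move=> /andP[c0 c1] /andP[v0 v1].
have v1k k : 0 <= 1 - v ^+ k by rewrite subr_ge0 exprn_ile1.
have [vc|cv] := ltP v c.
  have m1 k : 1 - (k%:R * (v / c) ^+ k + v ^+ k) <=
      (1 - v ^+ k) ^+ step_exponent c k.
    have vk1 : v ^+ k <= 1 by rewrite exprn_ile1.
    have /(_ ltac:(lra)) := @bernoulli_inequality (- v ^+ k) (step_exponent c k).
    apply: le_trans; rewrite mulrN lerD2l lerN2 expr_div_n mulrA mulrAC.
    rewrite -[X in _ <= _ + X]mul1r -mulrDl ler_wpM2r ?exprn_ge0//.
    by rewrite /step_exponent -natr1 lerD2r truncn_le divr_ge0// exprn_ge0// ltW.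
  apply: (@squeeze_cvgr _ _ _ _
    (fun k => 1 - (k%:R * (v / c) ^+ k + v ^+ k)) (cst 1)).
  - by apply: nearW => k; rewrite m1 exprn_ile1//= lerBlDr lerDl exprn_ge0.
  - rewrite -[X in _ --> X]subr0; apply: cvgB; first exact: cvg_cst.
    rewrite -[X in _ --> X]addr0; apply: cvgD.
      apply: cvg_natr_expr0; rewrite divr_ge0 ?(ltW c0)//=.
      by rewrite ltr_pdivrMr// mul1r.
    by apply: cvg_expr; rewrite ger0_norm// (lt_le_trans vc).
  - exact: cvg_cst.
have m1 k : (1 - v ^+ k) ^+ step_exponent c k <= k.+1%:R^-1.
  set m := step_exponent c k; set y := v ^+ k.
  have y0 : 0 <= y by rewrite exprn_ge0.
  have y1 : y <= 1 by rewrite exprn_ile1.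
  have km : k.+1%:R <= (1 + y) ^+ m.
    apply: (@le_trans _ _ (1 + m%:R * y)); last first.
      by apply: bernoulli_inequality; lra.
    rewrite -natr1 addrC lerD2l.
    apply: (@le_trans _ _ (m%:R * c ^+ k)).
      by rewrite -ler_pdivrMr ?exprn_gt0// ltW// truncnS_gt.
    by rewrite ler_wpM2l// lerXn2r// ?nnegrE// ltW.
  rewrite -[leRHS]div1r ler_pdivlMr ?ltr0n//.
  apply: (@le_trans _ _ ((1 - y) ^+ m * (1 + y) ^+ m)).
    by rewrite ler_wpM2l// exprn_ge0// v1k.
  by rewrite -exprMn exprn_ile1//; nra.
apply: (@squeeze_cvgr _ _ _ _ (cst 0) (@harmonic R)).
- by apply: nearW => k; rewrite exprn_ge0//= m1.
- exact: cvg_cst.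
- exact: cvg_harmonic.
Qed.

End step_approximation.

Section powers_are_total.
Import HBSimple HBNNSimple.
Context d (T : measurableType d) (R : realType).
Variables (mu : {measure set T -> \bar R}) (V : (T -> R) -> Prop).
Hypothesis cV : closed_subspace mu V.
Variables (w u : T -> R).
Hypotheses (mw : measurable_fun setT w) (mu_u : measurable_fun setT u).
Hypotheses (w0 : forall x, 0 <= w x) (u01 : forall x, 0 <= u x <= 1).
Hypothesis Vpow : forall j, V (fun x => w x * u x ^+ j.+1).

Let u0 x : 0 <= u x. Proof. by have /andP[] := u01 x. Qed.

Let wu0 x : 0 <= w x * u x. Proof. by rewrite mulr_ge0. Qed.

Let Vwu : V (fun x => w x * u x).
Proof. exact: (Vpow 0). Qed.

Let L1wu : L1 mu (fun x => w x * u x).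
Proof. exact: (closed_L1 cV). Qed.

Let mwuh (h : R -> R) : measurable_fun setT h ->
  measurable_fun setT (fun x => w x * u x * h (u x)).
Proof.
move=> mh; apply: measurable_funM; first exact: measurable_funM.
exact: measurableT_comp.
Qed.

Let V_poly (p : {poly R}) : V (fun x => w x * u x * p.[u x]).
Proof.
under [X in V X]eq_fun do rewrite horner_coef mulr_sumr.
apply: (closed_sum cV) => i; under [X in V X]eq_fun do
  rewrite mulrCA -mulrA -exprS.
exact: (closedZ cV).
Qed.

(* Polynomials in u converge boundedly to the indicator of u < c; the factor
   w u is an integrable bound. *)
Let V_ray c : V (fun x => w x * u x * \1_`]-oo, c[ (u x)).
Proof.
have ray x : \1_`]-oo, c[ (u x) = (u x < c)%R%:R :> R.
  by rewrite indicE mem_setE/= in_itv.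
have [c0|c0] := leP c 0.
  under [X in V X]eq_fun do rewrite ray ltNge (le_trans c0)// mulr0.
  exact: (closed0 cV).
have [c1|c1] := ltP 1 c.
  rewrite (_ : (fun x => _) = fun x => w x * u x)//; apply/funext => x.
  have /andP[_ /le_lt_trans ux1] := u01 x.
  by rewrite ray ux1// mulr1.
pose p k : {poly R} := (1 - 'X^k) ^+ step_exponent c k.
have pE k x : (p k).[x] = (1 - x ^+ k) ^+ step_exponent c k.
  by rewrite /p horner_exp !hornerE.
apply: (closed_dct cV _ L1wu (fun k => V_poly (p k))).
- exact: mwuh.
- move=> k x; rewrite pE normrM ger0_norm// ger0_norm; last first.
    by rewrite exprn_ge0// subr_ge0 exprn_ile1//; have /andP[] := u01 x.
  rewrite ler_piMr// exprn_ile1 ?subr_ge0 ?exprn_ile1 ?lerBlDr ?lerDl ?exprn_ge0//.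
  by have /andP[] := u01 x.
- apply: nearW => x; apply: cvgMl_tmp; rewrite ray.
  by under eq_fun do rewrite pE; apply: cvg_step; rewrite // c0.
Qed.

(* The Borel sets B whose indicator composed with u is reached form a Dynkin
   system, and the rays `]-oo, c[ are stable under intersection. *)
Let V_indic B : measurable B -> V (fun x => w x * u x * \1_B (u x)).
Proof.
have indicC S x : \1_(~` S) x = 1 - \1_S x :> R.
  by rewrite !indicE in_setC; case: (x \in S); rewrite ?subrr ?subr0.
have borelE := @RGenInftyO.measurableE R.
move=> mB; have {mB} : <<s @RGenInftyO.G R >> B by rewrite -[X in X B]borelE.
move: B; apply: (@dynkin_induction _ (measurableTypeR R) (@RGenInftyO.G R)
  (fun B => V (fun x => w x * u x * \1_B (u x)))).
- exact: borelE.
- move=> _ _ [a ->] [b ->]; exists (Order.min a b); apply/seteqP; split => x /=.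
    by rewrite !in_itv/= lt_min => -[-> ->].
  by rewrite !in_itv/= lt_min => /andP[].
- by under [X in V X]eq_fun do rewrite indicT mulr1.
- by move=> _ [c ->]; exact: V_ray.
- move=> S _ VS; under [X in V X]eq_fun do rewrite indicC mulrBr mulr1.
  exact: (closedB cV).
- move=> F mF tF VF.
  have VFN N : V (fun x => w x * u x * \1_(\bigcup_(k < N) F k) (u x)).
    elim: N => [|N IH].
      under [X in V X]eq_fun do rewrite bigcup_mkord big_ord0 indic0 mulr0.
      exact: (closed0 cV).
    rewrite (_ : (fun x => _) = fun x =>
        w x * u x * \1_(\bigcup_(k < N) F k) (u x) + w x * u x * \1_(F N) (u x)).
      exact: (closedD cV).
    apply/funext => x; rewrite -mulrDr; congr (_ * _).
    rewrite !bigcup_mkord big_ord_recr/= -bigcup_mkord !indicE in_setU.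
    have [xF|xF] := boolP (u x \in \bigcup_(k < N) F k); last by rewrite add0r.
    rewrite /= (_ : _ \in F N = false) ?addr0//; apply/negbTE/negP.
    rewrite inE => FN; move: xF; rewrite inE => -[k /= kN Fk].
    move/trivIsetP : tF => /(_ k N I I); rewrite neq_ltn kN => /(_ isT).
    by apply/eqP/set0P; exists (u x).
  apply: (closed_dct cV _ L1wu VFN).
  + by apply: mwuh; apply: measurable_indic; exact: bigcupT_measurable.
  + move=> k x; rewrite normrM ger0_norm// ler_piMr// indicE.
    by case: (_ \in _); rewrite ?normr1 ?normr0.
  + apply: nearW => x; apply: cvgMl_tmp; rewrite indicE.
    have [|xF] := boolP (u x \in _).
      rewrite inE => -[k _ Fk].
      apply: (@cvg_trans _ (cst (1 : R) @ \oo)); last exact: cvg_cst.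
      apply: near_eq_cvg; near=> N => /=; rewrite indicE mem_set//.
      by exists k => //=; near: N; exact: nbhs_infty_gt.
    under eq_fun do rewrite indicE.
    apply: (@cvg_trans _ (cst (0 : R) @ \oo)); last exact: cvg_cst.
    apply: near_eq_cvg; near=> N => /=; rewrite memNset// => -[k _ Fk].
    by move/negP : xF; apply; rewrite inE; exists k.
Unshelve. all: by end_near. Qed.

Let V_sfun (s : {sfun R >-> R}) : V (fun x => w x * u x * s (u x)).
Proof.
under [X in V X]eq_fun do rewrite fimfunEord mulr_sumr.
apply: (closed_sum cV) => i; under [X in V X]eq_fun do rewrite mulrCA.
by apply: (closedZ cV); apply: V_indic.
Qed.

Let V_ge0 (h : R -> R) : measurable_fun setT h -> (forall v, 0 <= h v) ->
  L1 mu (fun x => w x * u x * h (u x)) -> V (fun x => w x * u x * h (u x)).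
Proof.
move=> mh h0 h1.
have mh' : measurable_fun setT (EFin \o h) by exact/measurable_EFinP.
pose s := nnsfun_approx measurableT mh'.
have cs v : s k v @[k --> \oo] --> h v.
  have h0' x : [set: R] x -> (0 <= (EFin \o h) x)%E by rewrite /= lee_fin.
  by have /fine_cvgP[] := @cvg_nnsfun_approx _ _ _ _ measurableT _ mh' h0' v I.
have sh k v : s k v <= h v.
  rewrite -(cvg_lim _ (cs v))//; apply: nondecreasing_cvgn_le; last first.
    by apply/cvg_ex; exists (h v); exact: cs.
  by move=> i j ij; exact/lefP/nd_nnsfun_approx.
apply: (closed_dct cV (mwuh mh) h1 (fun k => V_sfun (s k))).
- move=> k x; rewrite ger0_norm ?mulr_ge0//; exact: ler_wpM2l (wu0 x) _ _ (sh k (u x)).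
- by apply: nearW => x; apply: cvgMl_tmp; exact: cs.
Qed.

(** A substitute for the Weierstrass approximation theorem, suited to mean
    convergence for a possibly infinite measure: the rays give the Borel sets,
    the Borel sets give simple functions, and simple functions give everything
    by dominated convergence. The weight w u, integrable because V contains
    it, is the reason for using positive powers only. *)
Theorem closed_subspace_powers (h : R -> R) : measurable_fun setT h ->
  L1 mu (fun x => w x * u x * h (u x)) -> V (fun x => w x * u x * h (u x)).
Proof.
move=> mh h1.
rewrite (_ : (fun x => _) = fun x =>
    w x * u x * h^\+ (u x) - w x * u x * h^\- (u x)); last first.
  by apply/funext => x; rewrite -mulrBr; congr (_ * _); rewrite -[in LHS](funrposBneg h).
apply: (closedB cV); apply: V_ge0.
- exact: measurable_funrpos.
- exact: funrpos_ge0.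
- apply: le_L1 h1 _; first exact/mwuh/measurable_funrpos.
  move=> x; rewrite !normrM ler_wpM2l// ger0_norm ?funrpos_ge0//.
  by rewrite /funrpos ge_max ler_norm normr_ge0.
- exact: measurable_funrneg.
- exact: funrneg_ge0.
- apply: le_L1 h1 _; first exact/mwuh/measurable_funrneg.
  move=> x; rewrite !normrM ler_wpM2l// ger0_norm ?funrneg_ge0//.
  by rewrite /funrneg ge_max -normrN ler_norm normr_ge0.
Qed.

End powers_are_total.

(** * Mixtures of a family of densities *)

Section mixtures.
Local Open Scope ereal_scope.
Context d d' (X : measurableType d) (T : measurableType d') (R : realType).
Variables (nu : {sigma_finite_measure set X -> \bar R})
          (mu : {sigma_finite_measure set T -> \bar R}).
Variable P : X * T -> R.
Hypotheses (mP : measurable_fun setT P) (P0 : forall z, (0 <= P z)%R).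
Hypothesis P1 : forall s, \int[mu]_x (P (s, x))%:E <= 1.
Implicit Types phi psi : X -> R.

Definition mixture phi (x : T) : R := (\int[nu]_s (phi s * P (s, x)))%R.

Let measurable_prod phi : measurable_fun setT phi ->
  measurable_fun setT (fun z : X * T => phi z.1 * P z)%R.
Proof. by move=> mphi; apply: measurable_funM => //; exact: measurableT_comp. Qed.

(** Tonelli, with the mass of each P (s, .) at most 1. *)
Lemma mixture_mass_le phi : measurable_fun setT phi ->
  \int[mu]_x \int[nu]_s `|phi s * P (s, x)|%:E <= \int[nu]_s `|phi s|%:E.
Proof.
move=> mphi.
have mphiP : measurable_fun setT (fun z : X * T => `|phi z.1 * P z|%:E).
  by apply/measurable_EFinP; apply: measurableT_comp => //; exact: measurable_prod.
rewrite -(fubini_tonelli (fun z => `|phi z.1 * P z|%:E))//.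
apply: ge0_le_integral => //.
- by move=> s _; exact: integral_ge0.
- exact: (measurable_fun_fubini_tonelli_F (fun z => `|phi z.1 * P z|%:E)).
- by apply/measurable_EFinP; exact: measurableT_comp.
- move=> s _ /=.
  under eq_integral do rewrite normrM [`|P _|%R]ger0_norm// EFinM.
  rewrite ge0_integralZl//.
  + by rewrite -[leRHS]mule1 lee_wpmul2l.
  + apply/measurable_EFinP; apply: measurableT_comp mP _.
    exact: measurable_pair1.
  + by move=> x _; rewrite lee_fin.
Qed.

Let integrable_prod phi : L1 nu phi ->
  (nu \x mu).-integrable setT (EFin \o (fun z : X * T => phi z.1 * P z)%R).
Proof.
move=> /[dup] phi1 /L1_measurable mphi; apply/integrable21ltyP.
  by apply/measurable_EFinP; exact: measurable_prod.
apply: le_lt_trans (mixture_mass_le mphi) _.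
by case/integrableP : phi1.
Qed.

Lemma ae_integrable_mixture phi : L1 nu phi ->
  {ae mu, forall x, L1 nu (fun s => phi s * P (s, x))%R}.
Proof. by move=> /integrable_prod /ae_integrable2. Qed.

Lemma L1_mixture phi : L1 nu phi -> L1 mu (mixture phi).
Proof.
move=> phi1; have mphi := L1_measurable phi1; have h := integrable_prod phi1.
have mmix : measurable_fun setT (EFin \o mixture phi).
  apply/measurable_EFinP; apply: (measurableT_comp (fine_measurable _)) => //.
  exact: measurable_fubini_G h.
have mphiP : measurable_fun setT (fun z : X * T => `|phi z.1 * P z|%:E).
  by apply/measurable_EFinP; apply: measurableT_comp => //; exact: measurable_prod.
apply/integrableP; split => //.
apply: le_lt_trans (le_lt_trans (mixture_mass_le mphi) _); last first.
  by case/integrableP : phi1.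
apply: ge0_le_integral => //.
- exact: measurableT_comp.
- exact: (measurable_fun_fubini_tonelli_G (fun z => `|phi z.1 * P z|%:E)).
- move=> x _; rewrite /mixture /Rintegral /=.
  have mx : measurable_fun setT (fun s => (phi s * P (s, x))%:E).
    apply/measurable_EFinP; apply: measurable_funM => //.
    by apply: measurableT_comp mP _; exact: measurable_pair2.
  apply: le_trans (le_abse_integral nu measurableT mx).
  by case: (\int[nu]_s _) => //= *; rewrite normr0 leey.
Qed.

Lemma mixtureD phi psi : L1 nu phi -> L1 nu psi ->
  {ae mu, forall x, mixture phi x + mixture psi x =
                    mixture (fun s => phi s + psi s) x}%R.
Proof.
move=> /ae_integrable_mixture h1 /ae_integrable_mixture h2.
apply: filterS2 h1 h2 => x h1 h2; rewrite /mixture -RintegralD//.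
by apply: eq_Rintegral => s _; rewrite mulrDl.
Qed.

Lemma mixtureZ c phi : L1 nu phi ->
  {ae mu, forall x, c * mixture phi x = mixture (fun s => c * phi s) x}%R.
Proof.
move=> /ae_integrable_mixture h1; apply: filterS h1 => x h1.
by rewrite /mixture -RintegralZl//; apply: eq_Rintegral => s _; rewrite mulrA.
Qed.

Lemma L1dist_mixture phi psi : L1 nu phi -> L1 nu psi ->
  L1dist mu (mixture phi) (mixture psi) <= L1dist nu phi psi.
Proof.
move=> phi1 psi1; have [mphi mpsi] := (L1_measurable phi1, L1_measurable psi1).
have mB : measurable_fun setT (fun s => phi s - psi s)%R.
  exact: measurable_funB.
apply: le_trans (mixture_mass_le mB); apply: ae_ge0_le_integral => //.
- apply/measurable_EFinP; apply: measurableT_comp => //.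
  by apply: measurable_funB; apply: (@L1_measurable _ _ _ mu); exact: L1_mixture.
- by move=> x _; exact: integral_ge0.
- apply: (measurable_fun_fubini_tonelli_G
    (fun z => `|(phi z.1 - psi z.1) * P z|%:E)) => //.
  by apply/measurable_EFinP; apply: measurableT_comp => //; exact: measurable_prod mB.
apply: filterS2 (ae_integrable_mixture phi1) (ae_integrable_mixture psi1).
move=> x h1 h2 _; rewrite /mixture -RintegralB//.
under eq_Rintegral do rewrite -mulrBl.
rewrite EFin_normr_Rintegral//; last first.
  rewrite (_ : _ \o _ = (fun s => (phi s * P (s, x))%:E) \-
                        (fun s => (psi s * P (s, x))%:E)).
    exact: integrableB.
  by apply/funext => s /=; rewrite mulrBl EFinB.
apply: le_abse_integral => //; apply/measurable_EFinP; apply: measurable_funM => //.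
by apply: measurableT_comp mP _; exact: measurable_pair2.
Qed.

(** The mixture map is a contraction, so membership of mixtures in V can be
    studied on the space of weights, where [closed_subspace_powers] applies. *)
Lemma closed_mixture (V : (T -> R) -> Prop) : closed_subspace mu V ->
  closed_subspace nu (fun phi => L1 nu phi /\ V (mixture phi)).
Proof.
move=> cV; split.
- by move=> f [].
- split; first exact: integrable0.
  rewrite (_ : mixture _ = fun=> 0%R); first exact: (closed0 cV).
  apply/funext => x; rewrite /mixture; under eq_Rintegral do rewrite mul0r.
  by rewrite Rintegral_cst// mul0r.
- move=> f g [f1 Vf] [g1 Vg]; split; first exact: L1D.
  apply: (closed_ae cV _ _ (mixtureD f1 g1)); first exact: (closedD cV).
  by apply: L1_measurable; apply: L1_mixture; exact: L1D.
- move=> c f [f1 Vf]; split; first exact: L1Z.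
  apply: (closed_ae cV _ _ (mixtureZ c f1)); first exact: (closedZ cV).
  by apply: L1_measurable; apply: L1_mixture; exact: L1Z.
- move=> f f1 fV; split => //; apply: (closed_lim cV); first exact: L1_mixture.
  move=> e /fV[g [g1 Vg] fg]; exists (mixture g) => //.
  exact: le_lt_trans (L1dist_mixture f1 g1) fg.
Qed.

End mixtures.

(** * Null sets *)

Section almost_everywhere.
Context d (T : measurableType d) (R : realType).
Variable mu : {measure set T -> \bar R}.

Lemma ae_mono (P Q : T -> Prop) :
  (forall x, P x -> Q x) -> {ae mu, forall x, P x} -> {ae mu, forall x, Q x}.
Proof. by move=> PQ; apply: filterS. Qed.

Lemma ae_mono2 (P P' Q : T -> Prop) :
  (forall x, P x -> P' x -> Q x) ->
  {ae mu, forall x, P x} -> {ae mu, forall x, P' x} -> {ae mu, forall x, Q x}.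
Proof. by move=> PQ; apply: filterS2. Qed.

Lemma ae_exists (D : set T) (P : T -> Prop) : measurable D -> mu D != 0%E ->
  {ae mu, forall x, P x} -> exists2 x, D x & P x.
Proof.
move=> mD D0 [N [mN N0 PN]]; apply: contrapT => noP; move/eqP : D0; apply.
apply: (subset_measure0 mD mN _ N0) => x Dx; apply: PN => Px.
by apply: noP; exists x.
Qed.

Lemma measure0_ae (N : set T) : measurable N -> mu N = 0%E -> {ae mu, forall x, ~ N x}.
Proof. by move=> mN N0; exists N; split => // x /= /contrapT. Qed.

Lemma ae_measure0 (N : set T) : measurable N -> {ae mu, forall x, ~ N x} -> mu N = 0%E.
Proof.
move=> mN [M [mM M0 NM]]; apply: (subset_measure0 mN mM _ M0) => x Nx.
by apply: NM => /(_ Nx).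
Qed.

End almost_everywhere.

Section null_sections.
Local Open Scope ereal_scope.
Context d1 d2 (T1 : measurableType d1) (T2 : measurableType d2) (R : realType).
Variables (m1 : {sigma_finite_measure set T1 -> \bar R})
          (m2 : {sigma_finite_measure set T2 -> \bar R}).
Variable A : set (T1 * T2).
Hypothesis mA : measurable A.

Let integral_eq0P d (T : measurableType d) (m : {measure set T -> \bar R})
    (f : T -> \bar R) : measurable_fun setT f -> (forall x, 0 <= f x) ->
  \int[m]_x f x = 0 <-> {ae m, forall x, f x = 0}.
Proof.
move=> mf f0.
under eq_integral do rewrite -[f _]gee0_abs//.
rewrite ae_eq_integral_abs//; split; apply: filterS => x; first exact.
by move=> + _.
Qed.

Lemma product_null_xsectionP :
  (m1 \x m2) A = 0 <-> {ae m1, forall x, m2 (xsection A x) = 0}.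
Proof.
by apply: (@integral_eq0P _ _ m1 (m2 \o xsection A)) => //;
  exact: measurable_fun_xsection.
Qed.

Lemma product_null_ysectionP :
  (m1 \x m2) A = 0 <-> {ae m2, forall y, m1 (ysection A y) = 0}.
Proof.
rewrite (@product_measure_unique _ _ _ _ _ m1 m2 (m1 \x^ m2))//; last first.
  by move=> B C mB mC; exact: product_measure2E.
by apply: (@integral_eq0P _ _ m2 (m1 \o ysection A)) => //;
  exact: measurable_fun_ysection.
Qed.

End null_sections.

(** * Integration and scaling in R^n *)

Section euclidean_space.
Context {R : realType}.
Local Notation lambda := (@lebesgue_measure R).

Lemma ge0_integral_Rn n (f : Rn R n.+1 -> \bar R) : measurable_fun setT f ->
  (forall x, 0 <= f x)%E ->
  (\int[lebesgue_Rn n.+1]_x f x =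
   \int[lambda]_a \int[lebesgue_Rn n]_t f (consRn (a, t)))%E.
Proof.
move=> mf f0.
rewrite [LHS](@ge0_integral_pushforward _ _ _ _ _ _ (@measurable_consRn R n)
  (lambda \x lebesgue_Rn n)%E setT f)//.
rewrite preimage_setT (fubini_tonelli1 (f \o @consRn R n))//.
  by apply: measurableT_comp mf _; exact: measurable_consRn.
by move=> p; exact: f0.
Qed.

Lemma norm2_ge0 n (x : Rn R n) : 0 <= norm2 x.
Proof. exact: sqrtr_ge0. Qed.

Lemma sqr_norm2 n (x : Rn R n) : norm2 x ^+ 2 = \sum_(i < n) tnth x i ^+ 2.
Proof. by rewrite sqr_sqrtr// sumr_ge0// => i _; exact: sqr_ge0. Qed.

Lemma sqr_norm2_cons n a (t : Rn R n) :
  norm2 (consRn (a, t)) ^+ 2 = a ^+ 2 + norm2 t ^+ 2.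
Proof.
rewrite !sqr_norm2 big_ord_recl tnth0; congr (_ + _).
by apply: eq_bigr => i _; rewrite tnthS.
Qed.

Lemma measurable_norm2 n : measurable_fun [set: Rn R n] (@norm2 R n).
Proof.
apply: (@measurableT_comp _ _ _ _ _ _ (@Num.sqrt R)).
  by apply: continuous_measurable_fun; exact: sqrt_continuous.
apply: measurable_sum => i; apply: measurable_funX; exact: measurable_tnth.
Qed.

Definition scaleRn n (c : R) (x : Rn R n) : Rn R n :=
  [tuple c * tnth x i | i < n].

Lemma norm2_scale n c (x : Rn R n) : 0 <= c -> norm2 (scaleRn c x) = c * norm2 x.
Proof.
move=> c0; apply/eqP; rewrite -(@eqrXn2 _ 2)// ?norm2_ge0 ?mulr_ge0 ?norm2_ge0//.
rewrite exprMn !sqr_norm2 mulr_sumr; apply/eqP/eq_bigr => i _.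
by rewrite tnth_mktuple exprMn.
Qed.

Lemma scaleRn_cons n c a (t : Rn R n) :
  scaleRn c (consRn (a, t)) = consRn (c * a, scaleRn c t).
Proof.
apply: eq_from_tnth => i; rewrite tnth_mktuple.
case: (unliftP ord0 i) => [j ->|->]; last by rewrite !tnth0.
by rewrite !tnthS tnth_mktuple.
Qed.

Lemma measurable_scale n :
  measurable_fun setT (fun p : measurableTypeR R * Rn R n => scaleRn p.1 p.2).
Proof.
apply/measurable_fun_tnthP => i.
rewrite (_ : _ \o _ = fun p : measurableTypeR R * Rn R n => p.1 * tnth p.2 i).
  apply: measurable_funM => //.
  by apply: (@measurableT_comp _ _ _ _ _ _ (fun x : Rn R n => tnth x i));
    [exact: measurable_tnth|].
by apply/funext => p; rewrite /= tnth_mktuple.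
Qed.

Lemma measurable_scalel n c : measurable_fun setT (@scaleRn n c).
Proof.
exact: (measurableT_comp (@measurable_scale n) (measurable_pair1 c)).
Qed.

Lemma lebesgue_measure_scale c (A : set (measurableTypeR R)) :
  0 < c -> measurable A ->
  lambda A = (c%:E * lambda ( *%R c @^-1` A))%E.
Proof.
move=> c0 mA.
have mc : measurable_fun [set: measurableTypeR R]
  ( *%R c : measurableTypeR R -> measurableTypeR R) by exact: mulrl_measurable.
have [nu nuE] : exists nu : {measure set (measurableTypeR R) -> \bar R},
    forall B, nu B = lambda ( *%R c @^-1` B).
  by unshelve eexists (pushforward lambda
    ( *%R c : measurableTypeR R -> measurableTypeR R)).
rewrite -nuE -[RHS]/(mscale (NngNum (ltW c0)) nu A).
apply: lebesgue_measure_unique => //= _ [[a b]] _ <-.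
rewrite /mscale /= nuE.
rewrite (_ : _ @^-1` _ = `]a / c, b / c]%classic); last first.
  apply/seteqP; split => x /=; rewrite !in_itv/= ltr_pdivrMr// ler_pdivlMr//;
    by rewrite mulrC.
rewrite !lebesgue_measure_itv/= !lte_fin ltr_pM2r ?invr_gt0//.
case: ifP => _; last by rewrite mule0.
by rewrite -!EFinD -EFinM -mulrBl mulrC divfK// gt_eqF.
Qed.

Lemma ae_scale1 c (Q : measurableTypeR R -> Prop) : 0 < c ->
  {ae lambda, forall a, Q a} -> {ae lambda, forall a, Q (c * a)}.
Proof.
move=> c0 [N [mN N0 QN]]; exists ( *%R c @^-1` N); split.
- by rewrite -[X in measurable X]setTI; exact: mulrl_measurable.
- apply/eqP; move/eqP : N0; rewrite (lebesgue_measure_scale c0 mN).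
  by rewrite mule_eq0 eqe gt_eqF.
- by move=> a /= Qca; exact: QN.
Qed.

Lemma lebesgue_Rn_cons n (A : set (Rn R n.+1)) :
  lebesgue_Rn n.+1 A = (lambda \x lebesgue_Rn n)%E (@consRn R n @^-1` A).
Proof. by []. Qed.

(** By induction on the dimension: a set is null when almost all its sections
    along the first coordinate are, and scaling acts on the sections and on
    the first coordinate separately. *)
Lemma ae_scale n c (Q : Rn R n -> Prop) : 0 < c ->
  {ae lebesgue_Rn n, forall x, Q x} ->
  {ae lebesgue_Rn n, forall x, Q (scaleRn c x)}.
Proof.
move=> c0; elim: n Q => [|n IH] Q [N [mN N0 QN]].
  have id0 x : scaleRn c x = x :> Rn R 0 by rewrite [LHS]tuple0 [RHS]tuple0.
  by exists N; split => // x /=; rewrite id0; exact: QN.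
exists (@scaleRn n.+1 c @^-1` N); split.
- by rewrite -[X in measurable X]setTI; exact: measurable_scalel.
- have mcons A : measurable A -> measurable (@consRn R n @^-1` A).
    by move=> mA; rewrite -[X in measurable X]setTI; exact: measurable_consRn.
  rewrite lebesgue_Rn_cons; apply/product_null_xsectionP.
    apply: mcons.
    by rewrite -[X in measurable X]setTI; exact: measurable_scalel.
  have {}/(product_null_xsectionP lambda (lebesgue_Rn n) (mcons _ mN)) := N0.
  move=> /(ae_scale1 c0); apply: ae_mono => a.
  set B := xsection _ _; set B' := xsection _ _ => B0.
  have mB : measurable B by apply: measurable_xsection; exact: mcons.
  have /IH : {ae lebesgue_Rn n, forall t, ~ B t}.
    by exists B; split => // t /=; apply: contrapT.
  have -> : B' = @scaleRn n c @^-1` B.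
    by apply/seteqP; split => t; rewrite /B /B' /xsection/= !inE/= scaleRn_cons.
  move=> [M [mM M0 BM]]; apply: (subset_measure0 _ mM _ M0).
    rewrite -[X in measurable X]setTI; exact: measurable_scalel.
  by move=> t /= Bt; apply: BM => /=.
- by move=> x /= Qx; exact: QN.
Qed.

Lemma lebesgue_Rn_setT n : (0 < n)%N -> lebesgue_Rn n [set: Rn R n] = +oo%E.
Proof.
move=> n0; have := @lebesgue_Rn_box R n (fun=> setT) (fun=> measurableT).
rewrite (_ : [set x | _] = setT); last by apply/seteqP; split.
case: n n0 => // n _ ->; rewrite big_ord_recl.
have -> : lambda setT = +oo%E.
  by rewrite -set_itvNyy lebesgue_measure_itv.
elim: n => [|n IH]; first by rewrite big_ord0 mule1.
by rewrite big_ord_recl IH.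
Qed.

Lemma norm2_eq0P n (x : Rn R n) : norm2 x = 0 <-> forall i, tnth x i = 0.
Proof.
split=> [x0 i|x0]; last first.
  by apply/eqP; rewrite -sqrf_eq0 sqr_norm2 big1// => i _; rewrite x0 expr0n.
apply/eqP; rewrite -sqrf_eq0; apply/eqP.
apply: (@psumr_eq0P _ _ xpredT (fun i => tnth x i ^+ 2)) => //.
  by move=> j _; exact: sqr_ge0.
by rewrite -sqr_norm2 x0 expr0n.
Qed.

Lemma ae_norm2_gt0 n : (0 < n)%N ->
  {ae lebesgue_Rn n, forall x : Rn R n, 0 < norm2 x}.
Proof.
case: n => // n _; exists [set x | forall i, [set 0] (tnth x i)]; split.
- rewrite (_ : [set x | _] = (@norm2 R n.+1) @^-1` [set 0]).
    by rewrite -[X in measurable X]setTI; exact: measurable_norm2.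
  by apply/seteqP; split => x /=; rewrite norm2_eq0P.
- have := @lebesgue_Rn_box R n.+1 (fun=> [set 0]) (fun=> measurable_set1 0).
  by rewrite big_ord_recl lebesgue_measure_set1 mul0e.
- move=> x /= /negP; rewrite -leNgt => x0; apply/norm2_eq0P/eqP.
  by rewrite eq_le x0 norm2_ge0.
Qed.

End euclidean_space.

(** * Radial functions are Borel functions of the norm *)

Section radial_functions.
Context {R : realType}.
Local Notation lambda := (@lebesgue_measure R).

(** The preimage under the norm of a null set M of radii is null. Consider the
    pairs (c, x) with c |x| in M: for fixed x <> 0 the c form a null set, as M
    is rescaled by |x|. Hence for almost every c > 0, thus for some c > 0, the
    x with c |x| in M form a null set; rescaling by c gives the claim. *)
Lemma ae_norm2 n (Q : measurableTypeR R -> Prop) : (0 < n)%N ->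
  {ae lambda, forall r, Q r} ->
  {ae lebesgue_Rn n, forall x : Rn R n, Q (norm2 x)}.
Proof.
move=> n0 [M [mM M0 QM]].
pose A := [set p : measurableTypeR R * Rn R n |
  [/\ 0 < p.1, 0 < norm2 p.2 & M (norm2 p.2 * p.1)]].
have mnorm2 : measurable_fun setT (fun p : measurableTypeR R * Rn R n => norm2 p.2).
  by apply: measurableT_comp (@measurable_norm2 R n) _.
have mA : measurable A.
  rewrite (_ : A = fst @^-1` `]0, +oo[ `&`
    (fun p => norm2 p.2) @^-1` `]0, +oo[ `&`
    (fun p => norm2 p.2 * p.1) @^-1` M); last first.
    apply/seteqP; split => -[c x]; rewrite /A /= !in_itv/= !andbT.
      by case.
    by case=> -[].
  apply: measurableI; first apply: measurableI.
  - by rewrite -[X in measurable X]setTI; exact: measurable_fst.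
  - by rewrite -[X in measurable X]setTI; exact: mnorm2.
  - by rewrite -[X in measurable X]setTI; apply: measurable_funM.
have /(product_null_xsectionP _ _ mA) : (lambda \x lebesgue_Rn n)%E A = 0%E.
  apply/(product_null_ysectionP _ _ mA); apply: aeW => x.
  apply: ae_measure0; first exact: measurable_ysection.
  have [x0|x0] := ltP 0 (norm2 x); last first.
    by apply: aeW => c; rewrite /ysection/= inE => -[_]; rewrite ltNge x0.
  have := ae_scale1 x0 (measure0_ae mM M0); apply: ae_mono => c Mc.
  by rewrite /ysection/= inE => -[].
have mpos : measurable (`]0, +oo[%classic : set (measurableTypeR R)) by [].
have pos0 : lambda `]0, +oo[%classic != 0%E.
  by rewrite lebesgue_measure_itv/= ltry.
move=> /(ae_exists mpos pos0)[c]; rewrite /= in_itv/= andbT => c0.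
move=> /(measure0_ae (measurable_xsection c mA)).
have c'0 : 0 < c^-1 by rewrite invr_gt0.
move=> /(ae_scale c'0) Ac; have := @ae_norm2_gt0 R _ n0; move: Ac.
apply: ae_mono2 => x; rewrite /xsection /= inE => nA x0.
apply: contrapT => /QM Mx; apply: nA; split => //=.
  by rewrite norm2_scale ?(ltW c'0)// mulr_gt0.
by rewrite norm2_scale ?(ltW c'0)// mulrAC mulVf ?mul1r// gt_eqF.
Qed.

(** The profile g of a radial function may fail to be measurable. If N is the
    exceptional null set, then for almost every (c, x) with c > 0 the point c
    x avoids N. So some x0 <> 0 is such that K (c x0) = g (c |x0|) for almost
    every c > 0: up to a null set of radii, which [ae_norm2] lifts to R^n, g
    is the restriction of K to the ray through x0. *)
Lemma radial_borel n (K : Rn R n -> R) : (0 < n)%N -> measurable_fun setT K ->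
  radial K -> exists2 h : R -> R, measurable_fun setT h &
    {ae lebesgue_Rn n, forall x, K x = h (norm2 x)}.
Proof.
move=> n0 mK [g [N [mN N0 KgN]]].
pose A := [set p : measurableTypeR R * Rn R n | 0 < p.1 /\ N (scaleRn p.1 p.2)].
have mA : measurable A.
  rewrite (_ : A = fst @^-1` `]0, +oo[ `&` (fun p => scaleRn p.1 p.2) @^-1` N).
    apply: measurableI.
      by rewrite -[X in measurable X]setTI; exact: measurable_fst.
    by rewrite -[X in measurable X]setTI; exact: measurable_scale.
  by apply/seteqP; split => -[c x]; rewrite /A /= in_itv/= andbT.
have /(product_null_ysectionP _ _ mA) : (lambda \x lebesgue_Rn n)%E A = 0%E.
  apply/(product_null_xsectionP _ _ mA); apply: aeW => c.
  apply: ae_measure0; first exact: measurable_xsection.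
  have [c0|c0] := ltP 0 c; last first.
    by apply: aeW => x; rewrite /xsection/= inE => -[]; rewrite ltNge c0.
  have := ae_scale c0 (measure0_ae mN N0); apply: ae_mono => x Nx.
  by rewrite /xsection/= inE => -[].
move=> Ax; have : {ae lebesgue_Rn n, forall x : Rn R n,
    0 < norm2 x /\ lambda (ysection A x) = 0%E}.
  by apply: ae_mono2 (ae_norm2_gt0 n0) Ax.
have RnT0 : lebesgue_Rn n [set: Rn R n] != 0%E by rewrite lebesgue_Rn_setT.
move=> /(ae_exists measurableT RnT0)[x0 _ [x00 S0]].
exists (fun r => K (scaleRn (r / norm2 x0) x0)).
  apply: measurableT_comp mK _.
  have mray : measurable_fun setT (fun r : measurableTypeR R =>
      (r / norm2 x0 : measurableTypeR R, x0)).
    by apply: measurable_fun_pair => //; exact: measurable_funM.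
  exact: (measurableT_comp (@measurable_scale R n) mray).
have x0'0 : 0 < (norm2 x0)^-1 by rewrite invr_gt0.
have := ae_norm2 n0 (ae_scale1 x0'0 (measure0_ae (measurable_ysection x0 mA) S0)).
have : {ae lebesgue_Rn n, forall x : Rn R n, ~ N x /\ 0 < norm2 x}.
  by apply: ae_mono2 (measure0_ae mN N0) (ae_norm2_gt0 n0).
move=> /[swap]; apply: ae_mono2 => x Sx [Nx xgt0].
have -> : K x = g (norm2 x) by apply: contrapT => /KgN.
set c := norm2 x / norm2 x0.
have c0 : 0 < c by rewrite divr_gt0.
have -> : K (scaleRn c x0) = g (norm2 (scaleRn c x0)).
  apply: contrapT => /KgN Nc; apply: Sx.
  by rewrite /ysection/= inE; split => //=; rewrite [_ * norm2 x]mulrC.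
by rewrite norm2_scale ?(ltW c0)// divfK// gt_eqF.
Qed.

End radial_functions.

(** * Gaussians and the heat kernel *)

Section heat_kernel.
Context {R : realType}.
Local Notation lambda := (@lebesgue_measure R).

Definition gauss n (t : R) (x : Rn R n) : R := expR (- (norm2 x ^+ 2 / (4 * t))).

Lemma gauss_ge0 n t (x : Rn R n) : 0 <= gauss t x.
Proof. exact: expR_ge0. Qed.

Lemma measurable_gauss n t : measurable_fun setT (@gauss n t).
Proof.
apply: measurableT_comp => //; apply: measurableT_comp => //.
apply: measurable_funM => //; apply: measurable_funX; exact: measurable_norm2.
Qed.

Lemma integral_gauss1 t : 0 < t ->
  (\int[lambda]_a (expR (- (a ^+ 2 / (4 * t))))%:E)%E = (Num.sqrt (4 * pi * t))%:E.
Proof.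
move=> t0; pose s : R := Num.sqrt (2 * t).
have s0 : s != 0 by rewrite gt_eqF// sqrtr_gt0 mulr_gt0.
have s2 : s ^+ 2 *+ 2 = 4 * t.
  by rewrite sqr_sqrtr ?mulr_ge0 ?(ltW t0)// -mulr_natr; ring.
have := @integral_normal_pdf R 0 s; rewrite (normal_pdfE _ s0).
under eq_integral => a _.
  rewrite /normal_fun subr0 s2 mulNr EFinM.
  over.
rewrite ge0_integralZl//; last 2 first.
- apply/measurable_EFinP; apply: measurableT_comp => //.
  by apply: measurableT_comp => //; exact: measurable_funM.
- by rewrite lee_fin normal_peak_ge0.
have -> : normal_peak s = (Num.sqrt (4 * pi * t))^-1.
  by rewrite /normal_peak -mulrnAl s2 mulrAC.
move=> /(congr1 (fun y => (Num.sqrt (4 * pi * t))%:E * y)%E).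
rewrite muleA -EFinM divff ?mul1e ?mule1//.
by rewrite gt_eqF// sqrtr_gt0 !mulr_gt0// pi_gt0.
Qed.

Lemma integral_gauss n t : 0 < t ->
  (\int[lebesgue_Rn n]_x (gauss t x)%:E)%E = (Num.sqrt (4 * pi * t) ^+ n)%:E.
Proof.
move=> t0; elim: n => [|n IH].
  rewrite integral_dirac//; last first.
    by apply/measurable_EFinP; exact: measurable_gauss.
  rewrite diracE in_setT mul1e /gauss /norm2 big_ord0 sqrtr0.
  by rewrite expr0n mul0r oppr0 expR0.
rewrite ge0_integral_Rn//; last 2 first.
- by apply/measurable_EFinP; exact: measurable_gauss.
- by move=> x; rewrite lee_fin gauss_ge0.
have slice a : (\int[lebesgue_Rn n]_x (gauss t (consRn (a, x)))%:E =
    (expR (- (a ^+ 2 / (4 * t))))%:E * (Num.sqrt (4 * pi * t) ^+ n)%:E)%E.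
  rewrite -IH -ge0_integralZl//.
  - apply: eq_integral => x _.
    by rewrite /gauss sqr_norm2_cons mulrDl opprD expRD EFinM.
  - by apply/measurable_EFinP; exact: measurable_gauss.
  - by move=> x _; rewrite lee_fin gauss_ge0.
under eq_integral do rewrite slice.
rewrite ge0_integralZr//.
- by rewrite integral_gauss1// -EFinM -exprS.
- apply/measurable_EFinP; apply: measurableT_comp => //.
  by apply: measurableT_comp => //; exact: measurable_funM.
Qed.

Lemma L1_gauss n t : 0 < t -> L1 (lebesgue_Rn n) (@gauss n t).
Proof.
move=> t0; apply/integrableP; split.
  by apply/measurable_EFinP; exact: measurable_gauss.
under eq_integral do rewrite /= ger0_norm ?gauss_ge0//.
by rewrite integral_gauss// ltry.
Qed.

(** [integral_gauss] at time exp s, in the form that occurs in the Green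
    function. *)
Definition gauss_mass (n : nat) (s : R) : R := (4 * pi * expR s) `^ (n%:R / 2).

(** The heat kernel at time exp s: the logarithm of the time is the parameter,
    so that the times run over the whole line with its translations. *)
Definition heat n (p : measurableTypeR R * Rn R n) : R :=
  (gauss_mass n p.1)^-1 * gauss (expR p.1) p.2.

Lemma powR_expR (a x : R) : 0 < a -> a `^ x = expR (x * ln a).
Proof. by move=> a0; rewrite /powR gt_eqF. Qed.

Lemma gauss_massE n s : gauss_mass n s = expR (n%:R / 2 * (ln 4 + ln pi + s)).
Proof.
rewrite /gauss_mass powR_expR ?mulr_gt0 ?expR_gt0 ?pi_gt0//.
by rewrite !lnM ?posrE ?mulr_gt0 ?expR_gt0 ?pi_gt0// expRK.
Qed.

Lemma gauss_mass_gt0 n s : 0 < gauss_mass n s.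
Proof. by rewrite gauss_massE expR_gt0. Qed.

Lemma gauss_mass_sqrt n s : gauss_mass n s = Num.sqrt (4 * pi * expR s) ^+ n.
Proof.
have h : 0 <= 4 * pi * expR s by rewrite !mulr_ge0 ?expR_ge0 ?pi_ge0.
rewrite -powR12_sqrt// -powR_mulrn ?powR_ge0// -powRrM /gauss_mass.
by congr (_ `^ _); rewrite mulrC.
Qed.

Lemma heat_ge0 n p : 0 <= @heat n p.
Proof. by rewrite mulr_ge0 ?gauss_ge0// invr_ge0 ltW// gauss_mass_gt0. Qed.

Lemma measurable_gauss_mass n : measurable_fun setT (gauss_mass n).
Proof.
rewrite (funext (gauss_massE n)).
apply: measurableT_comp => //; apply: measurable_funM => //.
exact: measurable_funD.
Qed.

Lemma heatE n s (x : Rn R n) :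
  heat (s, x) = expR (- (n%:R / 2 * (ln 4 + ln pi + s))) *
                expR (- (norm2 x ^+ 2 / 4 * expR (- s))).
Proof.
rewrite /heat /gauss /= gauss_massE -expRN; congr (_ * expR (- _)).
by rewrite expRN invfM mulrA.
Qed.

Lemma measurable_heat n : measurable_fun setT (@heat n).
Proof.
have m1 : measurable_fun setT (fst : measurableTypeR R * Rn R n -> R) by [].
have mn : measurable_fun setT (fun p : measurableTypeR R * Rn R n => norm2 p.2).
  by apply: measurableT_comp (@measurable_norm2 R n) _.
rewrite (_ : @heat n = fun p : measurableTypeR R * Rn R n =>
  expR (- (n%:R / 2 * (ln 4 + ln pi + p.1))) *
  expR (- (norm2 p.2 ^+ 2 / 4 * expR (- p.1)))); last first.
  by apply/funext => -[s x]; rewrite heatE.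
apply: measurable_funM.
  apply: measurableT_comp => //; apply: measurableT_comp => //.
  by apply: measurable_funM => //; exact: measurable_funD.
apply: measurableT_comp => //; apply: measurableT_comp => //.
apply: measurable_funM.
  by apply: measurable_funM => //; exact: measurable_funX.
by apply: measurableT_comp => //; exact: measurableT_comp.
Qed.

Lemma integral_heat n s : (\int[lebesgue_Rn n]_x (heat (s, x))%:E = 1)%E.
Proof.
rewrite /heat/=; under eq_integral do rewrite EFinM.
rewrite ge0_integralZl//.
- rewrite integral_gauss ?expR_gt0// -gauss_mass_sqrt -EFinM mulVf//.
  by rewrite gt_eqF// gauss_mass_gt0.
- by apply/measurable_EFinP; exact: measurable_gauss.
- by move=> x _; rewrite lee_fin gauss_ge0.
- by rewrite lee_fin invr_ge0 ltW// gauss_mass_gt0.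
Qed.

Lemma ge0_integral_translate (f : R -> R) a : continuous f ->
  (forall x, 0 <= f x) ->
  (\int[lambda]_s (f s)%:E = \int[lambda]_s (f (s + a))%:E)%E.
Proof.
move=> cf f0.
have a'1 : ((fun s : R => s + a)^`() = cst 1)%classic.
  by apply/funext => x; rewrite derive1E deriveD// derive_id derive_cst addr0.
rewrite (@increasing_ge0_integration_by_substitutionT _ (fun s => s + a))//.
- by apply: eq_integral => x _; rewrite a'1 /= mulr1.
- by move=> x y; rewrite ltrD2r.
- by rewrite a'1 => x; exact: cvg_cst.
- by rewrite a'1; exact: is_cvg_cst.
- by rewrite a'1; exact: is_cvg_cst.
- exact: cvg_addrr_Ny.
- exact: cvg_addrr.
Qed.

Lemma ge0_integral_fold (f : R -> R) : measurable_fun setT f ->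
  (forall x, 0 <= f x) ->
  (\int[lambda]_s (f s)%:E =
   \int[lambda]_(s in `[0%R, +oo[) (f s + f (- s))%:E)%E.
Proof.
move=> mf f0.
have mE : measurable_fun setT (EFin \o f) by exact/measurable_EFinP.
have mEN : measurable_fun setT (EFin \o (fun s => f (- s))).
  by apply/measurable_EFinP; exact: measurableT_comp.
under [RHS]eq_integral do rewrite EFinD.
rewrite ge0_integralD//; first last.
- exact: measurable_funTS mEN.
- by move=> x _; rewrite lee_fin.
- exact: measurable_funTS mE.
- by move=> x _; rewrite lee_fin.
rewrite [X in (_ + X)%E](@ge0_integration_by_substitution0 _ (fun s => (f (- s))%:E))//.
under [X in (_ + X)%E]eq_integral do rewrite opprK.
rewrite -(integral_itv_bndo_bndc (a := -oo%O)); last exact: measurable_funTS mE.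
rewrite -ge0_integral_setU//=.
- by rewrite setUC -setCitvr setvU.
- exact: measurable_funTS mE.
- by move=> x _; rewrite lee_fin.
- rewrite disj_set2E; apply/eqP; rewrite -subset0 => x []/=.
  by rewrite !in_itv/= andbT leNgt => /negP.
by move=> r; rewrite lee_fin.
Qed.

End heat_kernel.

(** * Green functions are mixtures of heat kernels *)

Section green_function.
Context {R : realType}.
Local Notation lambda := (@lebesgue_measure R).

(** The value 0 of [fine] at infinity is compatible with positive factors, so
    that the Bessel integral need not be known to be finite. *)
Lemma fine_mulr_ge0 (c : R) (y : \bar R) : 0 < c -> (0 <= y)%E ->
  fine (c%:E * y)%E = c * fine y.
Proof.
move=> c0; case: y => //= _.
by rewrite gt0_muley ?lte_fin//= mulr0.
Qed.

(** The density exp(- t / d) / d of the exponential law of mean d, with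
    respect to ds where t = exp s. *)
Definition green_weight (d s : R) : R := d^-1 * expR s * expR (- (expR s / d)).

Lemma measurable_cosh : measurable_fun setT (@cosh R).
Proof.
apply: measurable_funM => //; apply: measurable_funD => //.
by apply: measurableT_comp.
Qed.

Lemma cosh_weight_integral (rho nu : R) :
  (\int[lambda]_s (expR (- rho * cosh s) * expR (- nu * s))%:E =
   2%:E * \int[lambda]_(s in `[0%R, +oo[) (expR (- rho * cosh s) * cosh (nu * s))%:E)%E.
Proof.
have coshN s : cosh (- s) = cosh s :> R by rewrite /cosh opprK addrC.
have mcoshnu : measurable_fun setT (fun s : R => cosh (nu * s)).
  by apply: measurableT_comp; [exact: measurable_cosh|exact: measurable_funM].
have mexp : measurable_fun setT (fun s : R => expR (- rho * cosh s)).
  by apply: measurableT_comp => //; apply: measurable_funM => //; exact: measurable_cosh.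
rewrite ge0_integral_fold; last 2 first.
- apply: measurable_funM => //.
  by apply: measurableT_comp => //; exact: measurable_funM.
- by move=> s; rewrite mulr_ge0// expR_ge0.
rewrite -ge0_integralZl//; last 2 first.
- apply/measurable_EFinP; exact: measurable_funTS (measurable_funM mexp mcoshnu).
- by move=> s _; rewrite lee_fin mulr_ge0 ?expR_ge0// divr_ge0// addr_ge0 ?expR_ge0.
apply: eq_integral => s _; rewrite -EFinM; congr EFin.
by rewrite coshN mulrNN [- nu * s]mulNr [cosh (nu * s)]/cosh; field.
Qed.

(** The resolvent is the Laplace transform of the heat semigroup. Translating
    s by [a], that is taking sqrt d |x| / 2 as unit of time, turns the
    exponent - t / d - |x| ^ 2 / (4 t) into - rho cosh s with rho = |x| / sqrt
    d, and folding the line onto the half line gives the Bessel integral. The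
    point x = 0 is excluded as that integral diverges there. *)
Lemma green_mixture n (d : R) (x : Rn R n) : 0 < d -> 0 < norm2 x ->
  green d x = mixture lambda (@heat R n) (green_weight d) x.
Proof.
move=> d0 x0; set r := norm2 x in x0 *.
pose h : R := n%:R / 2; pose L := ln d; pose l := ln r.
have dE : d = expR L by rewrite lnK.
have rE : r = expR l by rewrite lnK.
pose F s := expR (- L + s - h * (ln 4 + ln pi + s)) *
            expR (- (expR (s - L) + r ^+ 2 / 4 * expR (- s))).
have FE s : green_weight d s * heat (s, x) = F s.
  rewrite heatE /green_weight /F -/h -/r {1 2}dE -expRN -!expRD.
  by congr expR; rewrite expRD; ring.
(* exp a = sqrt d |x| / 2 *)
pose a := L / 2 + l - ln 2.
pose rho := r / Num.sqrt d.
have rho0 : 0 < rho by rewrite divr_gt0// sqrtr_gt0.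
have rhoE : rho = expR (l - L / 2).
  rewrite /rho -powR12_sqrt ?(ltW d0)// powR_expR// -/L rE -expRN -expRD.
  by congr expR; ring.
pose C := expR (- L + a - h * (ln 4 + ln pi + a)).
have ln4 : ln 4 = 2 * ln 2 :> R.
  by rewrite (_ : 4 = 2 * 2) ?lnM ?posrE//; ring.
have e2 : 2^-1 = expR (- ln 2) :> R by rewrite expRN lnK ?posrE.
have e4 : 4^-1 = expR (- (2 * ln 2)) :> R by rewrite -ln4 expRN lnK ?posrE.
have FaE s : F (s + a) = C * (expR (- rho * cosh s) * expR (- (h - 1) * s)).
  rewrite /F /C -!expRD; congr expR.
  have -> : expR (s + a - L) = rho / 2 * expR s.
    rewrite e2 rhoE -!expRD; congr expR.
    by rewrite /a; field.
  have -> : r ^+ 2 / 4 * expR (- (s + a)) = rho / 2 * expR (- s).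
    rewrite e2 rhoE rE e4 -expRM_natl -!expRD; congr expR.
    by rewrite /a; field.
  by rewrite /cosh; field.
have cF : continuous F.
  move=> s; apply: cvgM; apply: (cvg_comp _ expR);
    [|exact: continuous_expR| |exact: continuous_expR].
    apply: cvgB; first by apply: cvgD; [exact: cvg_cst|exact: cvg_id].
    by apply: cvgMl_tmp; apply: cvgD; [exact: cvg_cst|exact: cvg_id].
  apply: cvgN; apply: cvgD.
    apply: (cvg_comp _ expR); last exact: continuous_expR.
    by apply: cvgB; [exact: cvg_id|exact: cvg_cst].
  apply: cvgMl_tmp; apply: (cvg_comp _ expR); last exact: continuous_expR.
  by apply: cvgN; exact: cvg_id.
have F0 s : 0 <= F s by rewrite mulr_ge0 ?expR_ge0.
rewrite /mixture /Rintegral.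
under eq_integral do rewrite FE.
rewrite (ge0_integral_translate a)//.
under eq_integral do rewrite FaE EFinM.
rewrite ge0_integralZl//; first last.
- by rewrite lee_fin expR_ge0.
- apply/measurable_EFinP; apply: measurable_funM.
    apply: measurableT_comp => //; apply: measurable_funM => //.
    exact: measurable_cosh.
  by apply: measurableT_comp => //; exact: measurable_funM.
rewrite cosh_weight_integral// muleA -EFinM fine_mulr_ge0; last 2 first.
- by rewrite mulr_gt0 ?expR_gt0.
- apply: integral_ge0 => s _; rewrite lee_fin mulr_ge0 ?expR_ge0//.
  by rewrite divr_ge0// addr_ge0 ?expR_ge0.
rewrite /green /greenG -/r -/rho -/h /besselK /Rintegral !mulrA; congr (_ * _).
have pi2_gt0 : 0 < 2 * pi :> R by rewrite mulr_gt0 ?pi_gt0.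
rewrite !powR_expR ?invr_gt0//.
rewrite lnV ?posrE// lnM ?posrE ?pi_gt0// rhoE expRK -/L -expRN -!expRD.
have -> : C * 2 = expR (- L + a - h * (ln 4 + ln pi + a) + ln 2).
  by rewrite expRD lnK ?posrE.
by congr expR; rewrite ln4 /a; field.
Qed.

Lemma L1_expR_opp_norm : L1 lambda (fun s : R => expR (- `|s|)).
Proof.
have mexp : measurable_fun setT (fun s : R => expR (- `|s|)).
  by apply: measurableT_comp => //; exact: measurableT_comp.
apply/integrableP; split; first exact/measurable_EFinP.
under eq_integral do rewrite /= ger0_norm ?expR_ge0//.
rewrite ge0_integral_fold//.
have mpdf := @measurable_exponential_pdf R 1.
have pdf0 s : (0 <= (exponential_pdf (1 : R) s)%:E)%E.
  by rewrite lee_fin exponential_pdf_ge0.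
have -> : (\int[lambda]_(s in `[0%R, +oo[) (expR (- `|s|) + expR (- `|- s|))%:E =
    \int[lambda]_(s in `[0%R, +oo[) (2%:E * (exponential_pdf (1 : R) s)%:E))%E.
  apply: eq_integral => s; rewrite inE/= in_itv/= andbT => s0.
  rewrite exponential_pdfE// normrN ger0_norm// mulN1r mul1r -EFinM.
  by congr EFin; ring.
rewrite ge0_integralZl//; last exact/measurable_EFinP/measurable_funTS.
rewrite lte_mul_pinfty//.
have mpdfE : measurable_fun setT (EFin \o exponential_pdf (1 : R)).
  exact/measurable_EFinP.
apply: (@le_lt_trans _ _ (\int[lambda]_s (exponential_pdf (1 : R) s)%:E))%E.
  exact: ge0_subset_integral.
by rewrite integral_exponential_pdf// ltry.
Qed.

(** The weight is of order exp s at minus infinity; at plus infinity, z ^ 2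
    exp(- z) <= 2 with z = exp s / d bounds it by a multiple of exp(- s). *)
Lemma L1_green_weight d : 0 < d -> L1 lambda (green_weight d).
Proof.
move=> d0; apply: le_L1 (L1Z (d^-1 + 2 * d) L1_expR_opp_norm) _.
  apply: measurable_funM; first exact: measurable_funM.
  by apply: measurableT_comp => //; apply: measurableT_comp => //; exact: measurable_funM.
move=> s; have d'0 : 0 < d^-1 by rewrite invr_gt0.
have d20 : 0 <= 2 * d by rewrite mulr_ge0// ltW.
rewrite [leLHS]ger0_norm ?mulr_ge0 ?expR_ge0 ?(ltW d'0)//.
rewrite [leRHS]ger0_norm; last by rewrite mulr_ge0 ?expR_ge0// addr_ge0// ltW.
have es := expR_gt0 s; have [s0|s0] := leP 0 s.
  rewrite ger0_norm// expRN ler_pdivlMr// /green_weight.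
  pose z := expR s / d; have z0 : 0 <= z by rewrite divr_ge0 ?(ltW d0) ?(ltW es).
  have -> : expR s = d * z by rewrite /z mulrC divfK// gt_eqF.
  have dn0 : d != 0 by rewrite gt_eqF.
  have -> : d * z / d = z by field.
  have -> : d^-1 * (d * z) * expR (- z) * (d * z) = d * (z ^+ 2 * expR (- z)).
    by field.
  have : z ^+ 2 * expR (- z) <= 2.
    rewrite expRN ler_pdivrMr ?expR_gt0//.
    have := expR_ge1Dxn 1 z0; rewrite (_ : 2`! = 2)//; lra.
  nra.
rewrite ltr0_norm// opprK /green_weight.
have : expR (- (expR s / d)) <= 1.
  by rewrite -expR0 ler_expR oppr_le0 divr_ge0 ?(ltW d0)// ltW.
have : 0 <= d^-1 * expR s by rewrite mulr_ge0 ?(ltW d'0) ?(ltW es).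
have : 0 <= d * expR s by rewrite mulr_ge0 ?(ltW d0) ?(ltW es).
nra.
Qed.

End green_function.

(** * The closed span of the Green functions *)

Section green_span.
Context {R : realType}.
Variable n : nat.
Hypothesis n0 : (0 < n)%N.
Local Notation lambda := (@lebesgue_measure R).
Local Notation lambdan := (@lebesgue_Rn R n).

Let mixture_heat (phi : measurableTypeR R -> R) : Rn R n -> R :=
  mixture lambda (@heat R n) phi.

Let heat_mass s : (\int[lambdan]_x (heat (s, x))%:E <= 1)%E.
Proof. by rewrite integral_heat. Qed.

Let L1_mixture_heat phi : L1 lambda phi -> L1 lambdan (mixture_heat phi).
Proof.
by move=> ?; apply: L1_mixture => //; [exact: measurable_heat|exact: heat_ge0].
Qed.

Lemma ae_green_mixture (d : R) : 0 < d ->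
  {ae lambdan, forall x, green d x = mixture_heat (green_weight d) x}.
Proof.
by move=> d0; apply: ae_mono (ae_norm2_gt0 n0) => x; exact: green_mixture.
Qed.

(** At the origin, where [green_mixture] does not apply, the Green function
    has some constant value. *)
Lemma measurable_green (d : R) : 0 < d -> measurable_fun setT (@green R n d).
Proof.
move=> d0.
rewrite (_ : @green R n d = fun x => if norm2 x == 0
    then d `^ (- (n%:R / 2)) * greenG n 0
    else mixture_heat (green_weight d) x).
  apply: measurable_fun_ifT => //.
    exact: (measurable_fun_eqr (@measurable_norm2 R n)).
  exact: L1_measurable (L1_mixture_heat (L1_green_weight d0)).
apply/funext => x; case: ifPn => [/eqP x0|x0]; first by rewrite /green x0 mul0r.
by rewrite green_mixture// lt_neqAle eq_sym x0 norm2_ge0.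
Qed.

Lemma L1_green (d : R) : 0 < d -> L1 lambdan (@green R n d).
Proof.
move=> d0; apply: L1_ae (L1_mixture_heat (L1_green_weight d0)) _ _.
  exact: measurable_green.
by apply: ae_mono (ae_green_mixture d0) => x ->.
Qed.

Variable V : (Rn R n -> R) -> Prop.
Hypothesis cV : closed_subspace lambdan V.
Hypothesis Vgreen : forall d : R, 0 < d -> V (@green R n d).

Let V_mixture_green_weight d : 0 < d -> V (mixture_heat (green_weight d)).
Proof.
move=> d0; apply: (closed_ae cV (Vgreen d0)); last exact: ae_green_mixture.
exact: L1_measurable (L1_mixture_heat (L1_green_weight d0)).
Qed.

(** With u = exp(- exp s), the weight of the Green function for d = 1 / j is a
    multiple of exp s u ^ j; and every function of s is a function of u,
    because s can be recovered from u. *)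
Lemma mixture_heat_in_green_span phi : L1 lambda phi -> V (mixture_heat phi).
Proof.
move=> phi1; have mphi := L1_measurable phi1.
have cV' := closed_mixture lambda (@measurable_heat R n) (@heat_ge0 R n) heat_mass cV.
pose u (s : measurableTypeR R) : R := expR (- expR s).
(* The inverse of u on `]0, 1[. *)
pose logu (v : measurableTypeR R) : R := ln (- ln v).
have loguK s : logu (u s) = s by rewrite /logu /u expRK opprK expRK.
pose h v := phi (logu v) * (expR (- logu v) * expR (expR (logu v))).
have hE : phi = (fun s => expR s * u s * h (u s)).
  apply/funext => s; rewrite /h loguK mulrCA [X in _ * X]mulrACA.
  by rewrite /u -!expRD subrr addNr addr0 expR0 mulr1.
have mlogu : measurable_fun setT logu.
  apply: measurableT_comp; first exact: measurable_ln.
  by apply: measurableT_comp => //; exact: measurable_ln.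
rewrite hE.
have := closed_subspace_powers cV' (w := expR) (u := u) _ _ _ _ _ (h := h).
move=> /(_ _ _ _ _ _ _ _)/proj2; apply.
- exact: measurable_expR.
- by apply: measurableT_comp => //; exact: measurableT_comp.
- exact: expR_ge0.
- move=> s; rewrite expR_ge0 -[leRHS]expR0 ler_expR oppr_le0; exact: expR_ge0.
- move=> j; have j0 : 0 < j.+1%:R^-1 :> R by rewrite invr_gt0.
  rewrite (_ : (fun s => _) = fun s => j.+1%:R^-1 * green_weight j.+1%:R^-1 s).
    by apply: (closedZ cV'); split; [exact: L1_green_weight|exact: V_mixture_green_weight].
  apply/funext => s; rewrite /green_weight invrK !mulrA mulVf// mul1r.
  by rewrite /u -expRM_natl mulrN [_%:R * expR s]mulrC.
- apply: measurable_funM; first exact: measurableT_comp mphi mlogu.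
  apply: measurable_funM; first by apply: measurableT_comp => //; exact: measurableT_comp.
  by apply: measurableT_comp => //; exact: measurableT_comp.
- by rewrite -hE.
Qed.

(** A Gaussian is the limit of averages of Gaussians over the logarithmic
    times in [s0 - 1 / (k + 1), s0]; since [gauss] increases with time, the
    averages lie between the values at the two endpoints. Weighting by
    [gauss_mass] turns the average into a mixture of heat kernels. *)
Lemma gauss_in_green_span t : 0 < t -> V (@gauss R n t).
Proof.
move=> t0; pose s0 := ln t.
have gE s (x : Rn R n) : gauss (expR s) x = expR (- (norm2 x ^+ 2 / 4 * expR (- s))) :> R.
  by rewrite /gauss invfM mulrA [expR (- s)]expRN.
have tE : gauss t = gauss (expR s0) :> (Rn R n -> R) by rewrite lnK.
pose J k : set (measurableTypeR R) := `[s0 - k.+1%:R^-1, s0]%classic.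
pose phi k s := k.+1%:R * \1_(J k) s * gauss_mass n s.
have phiE k (x : Rn R n) s : phi k s * heat (s, x) = k.+1%:R * \1_(J k) s * gauss (expR s) x.
  by rewrite /phi /heat /= mulrA mulfK// gt_eqF// gauss_mass_gt0.
have k0 k : 0 <= k.+1%:R :> R by [].
have i0 k s : 0 <= \1_(J k) s :> R by [].
have L1i k : L1 lambda (\1_(J k) : R -> R).
  exact: (@integrable_indic_itv R (s0 - k.+1%:R^-1) s0 true false).
have L1J k c : L1 lambda (fun s => k.+1%:R * \1_(J k) s * c).
  under [X in L1 _ X]eq_fun do rewrite mulrAC.
  by apply: L1Z; exact: L1i.
have mJ k : measurable_fun setT (fun s => k.+1%:R * \1_(J k) s : R).
  by apply: measurable_funM => //; apply: measurable_indic; exact: measurable_itv.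
have JE k c : \int[lambda]_s (k.+1%:R * \1_(J k) s * c) = c.
  under eq_Rintegral do rewrite mulrAC.
  rewrite RintegralZl//; last exact: L1i.
  have JE : lambda (J k) = (k.+1%:R^-1)%:E.
    by rewrite lebesgue_measure_itv/= lte_fin ltrBlDr ltrDl invr_gt0 ltr0n -EFinD subKr.
  rewrite /Rintegral integral_indic ?setIT; [|by []|exact: measurable_itv].
  rewrite [X in fine X]JE /=.
  by rewrite mulrAC mulfV ?mul1r// pnatr_eq0.
have gle s s' (x : Rn R n) : s <= s' -> gauss (expR s) x <= gauss (expR s') x.
  move=> ss; rewrite !gE ler_expR lerN2 ler_wpM2l ?divr_ge0 ?sqr_ge0//.
  by rewrite ler_expR lerN2.
have JP k s (a b : R) : (J k s -> a <= b) ->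
    k.+1%:R * \1_(J k) s * a <= k.+1%:R * \1_(J k) s * b.
  rewrite indicE; have [|_] := boolP (s \in J k); last by rewrite mulr0 !mul0r.
  by rewrite inE => Js /(_ Js); rewrite mulr1 ler_pM2l.
have J_le k s : J k s -> s0 - k.+1%:R^-1 <= s /\ s <= s0.
  by rewrite /J /= in_itv/= => /andP.
have Jge0 k s (c : R) : 0 <= c -> 0 <= k.+1%:R * \1_(J k) s * c.
  by move=> c0; rewrite mulr_ge0// mulr_ge0.
have phi1 k : L1 lambda (phi k).
  apply: le_L1 (L1J k (gauss_mass n s0)) _.
    by apply: measurable_funM => //; exact: measurable_gauss_mass.
  move=> s; have mass0 (s' : R) := ltW (gauss_mass_gt0 n s').
  rewrite (ger0_norm (Jge0 _ _ _ (mass0 s))) (ger0_norm (Jge0 _ _ _ (mass0 s0))).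
  apply: JP => /J_le[_ ss0]; rewrite !gauss_massE ler_expR.
  by rewrite ler_wpM2l ?divr_ge0// lerD2l.
have phig1 k (x : Rn R n) :
    L1 lambda (fun s => k.+1%:R * \1_(J k) s * gauss (expR s) x).
  apply: le_L1 (L1J k (gauss (expR s0) x)) _.
    apply: measurable_funM => //; under eq_fun do rewrite gE.
    apply: measurableT_comp => //; apply: measurableT_comp => //.
    by apply: measurable_funM => //; apply: measurableT_comp => //; exact: measurableT_comp.
  move=> s; rewrite (ger0_norm (Jge0 _ _ _ (gauss_ge0 (expR s) x))).
  rewrite (ger0_norm (Jge0 _ _ _ (gauss_ge0 (expR s0) x))).
  by apply: JP => /J_le[_ ss0]; exact: gle.
have mix_le k (x : Rn R n) : mixture_heat (phi k) x <= gauss t x.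
  rewrite /mixture_heat /mixture; under eq_Rintegral do rewrite phiE.
  rewrite -[leRHS](JE k) tE.
  apply: le_Rintegral => //; [exact: phig1|exact: L1J|].
  by move=> s _; apply: JP => /J_le[_ ss0]; exact: gle.
have le_mix k (x : Rn R n) :
    gauss (expR (s0 - k.+1%:R^-1)) x <= mixture_heat (phi k) x.
  rewrite /mixture_heat /mixture; under eq_Rintegral do rewrite phiE.
  rewrite -[leLHS](JE k).
  apply: le_Rintegral => //; [exact: L1J|exact: phig1|].
  by move=> s _; apply: JP => /J_le[ss0 _]; exact: gle.
apply: (closed_dct cV _ (L1_gauss n t0)
  (fun k => mixture_heat_in_green_span (phi1 k))).
- exact: measurable_gauss.
- by move=> k x; rewrite ger0_norm// (le_trans _ (le_mix k x))// gauss_ge0.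
- apply: aeW => x.
  apply: (@squeeze_cvgr _ _ _ _
    (fun k => gauss (expR (s0 - k.+1%:R^-1)) x) (cst (gauss t x))).
  + by apply: nearW => k; rewrite le_mix mix_le.
  + rewrite tE gE; under eq_fun do rewrite gE.
    apply: (cvg_comp _ expR); last exact: continuous_expR.
    apply: cvgN; apply: cvgMl_tmp.
    apply: (cvg_comp _ expR); last exact: continuous_expR.
    apply: cvgN; rewrite -[X in _ --> X]subr0; apply: cvgB; first exact: cvg_cst.
    exact: cvg_harmonic.
  + exact: cvg_cst.
Qed.

(** The powers of u = exp(- |x| ^ 2) are Gaussians, and a Borel function of
    |x| is a Borel function of u. *)
Theorem radial_in_green_span K : L1 lambdan K -> radial K -> V K.
Proof.
move=> K1 /(radial_borel n0 (L1_measurable K1))[h mh Kh].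
pose u := @gauss R n 4^-1.
have uE x : u x = expR (- norm2 x ^+ 2) by rewrite /u /gauss divff// divr1.
pose H v := h (Num.sqrt (- ln v)) * expR (- ln v).
have HE x : 1 * u x * H (u x) = h (norm2 x).
  rewrite mul1r /H uE expRK opprK sqrtr_sqr ger0_norm ?norm2_ge0//.
  by rewrite mulrCA -expRD addNr expR0 mulr1.
have mh2 : measurable_fun setT (fun x : Rn R n => h (norm2 x)).
  exact: measurableT_comp mh (@measurable_norm2 R n).
have h1 : L1 lambdan (fun x => h (norm2 x)) by exact: L1_ae K1 mh2 Kh.
apply: (@closed_ae _ _ _ _ _ cV _ (fun x => h (norm2 x))); last 2 first.
- exact: L1_measurable K1.
- by apply: ae_mono Kh => x ->.
rewrite -(funext HE).
have mln : measurable_fun setT (fun v : R => - ln v).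
  by apply: measurableT_comp => //; exact: measurable_ln.
apply: (closed_subspace_powers cV (w := fun=> 1) (u := u)) => //.
- exact: measurable_gauss.
- move=> x; rewrite uE expR_ge0 -[leRHS]expR0 ler_expR oppr_le0 sqr_ge0//.
- move=> j; rewrite (_ : (fun x => _) = @gauss R n (4 * j.+1%:R)^-1).
    by apply: gauss_in_green_span; rewrite invr_gt0 mulr_gt0.
  apply/funext => x; rewrite mul1r uE -expRM_natl /gauss; congr expR.
  by rewrite [(4 * j.+1%:R)^-1]invfM mulrA divff// mul1r invrK mulrN mulrC.
- apply: measurable_funM.
    apply: measurableT_comp mh _; apply: measurableT_comp mln.
    by apply: continuous_measurable_fun; exact: sqrt_continuous.
  exact: measurableT_comp.
- by rewrite (funext HE).
Qed.

End green_span.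

(** * Density of the linear combinations of Green functions *)

Theorem theorem4 (R : realType) (n : nat) (hn : (0 < n)%N) (K : Rn R n -> R)
    (hK : K \in Lfun (lebesgue_Rn n) 1%E) (hKrad : radial K)
    (eps : R) (heps : 0 < eps) :
  exists (N : nat) (alpha d : 'I_N -> R),
    [/\ (0 < N)%N,
        forall j, 0 < d j &
        ('N[lebesgue_Rn n]_1
           [EFin \o (fun x => K x - \sum_(j < N) alpha j * green (d j) x)%R]
         < eps%:E)%E].
Proof.
have K1 : L1 (lebesgue_Rn n) K by exact/Lfun1_integrable.
pose G (d : {posnum R}) : Rn R n -> R := green d%:num.
have G1 d : L1 (lebesgue_Rn n) (G d) by exact: L1_green.
have [_ Kapprox] : approximable (lebesgue_Rn n) G K.
  apply: (radial_in_green_span hn (closed_approximable G1)) => // d d0.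
  exact: approximable_gen G1 (PosNum d0).
have [s Ks] := Kapprox _ heps.
(* A null first term makes the number of terms positive. *)
pose p0 : R * {posnum R} := (0, PosNum ltr01).
pose s' := p0 :: s.
exists (size s'), (fun j => (nth p0 s' j).1),
  (fun j => (nth p0 s' j).2%:num); split => //.
rewrite Lnorm1; apply: le_lt_trans Ks; rewrite le_eqVlt; apply/orP; left.
apply/eqP; apply: eq_integral => x _ /=; congr (`|_ - _|%:E).
have <- : \sum_(p <- s') p.1 * G p.2 x = \sum_(j < size s')
    (nth p0 s' j).1 * green (nth p0 s' j).2%:num x.
  by rewrite (big_nth p0) big_mkord.
by rewrite big_cons mul0r add0r.
Qed.
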